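(* Let $\mathcal C,\mathcal C'$ be $\mathfrak g$-categorifications with data $(E,F,\eta_1,\epsilon_1,X,\sigma,\mathcal C=\bigoplus_\omega\mathcal C_\omega)$ and $(E',F',\eta_1',\epsilon_1',X',\sigma',\mathcal C'=\bigoplus_\omega\mathcal C'_\omega)$, equipped with fixed further adjunctions $(F,E,\eta_2,\epsilon_2)$ and $(F',E',\eta_2',\epsilon_2')$ such that these bi-adjunctions are compatible with $X,\sigma$ and $X',\sigma'$ respectively. Let $(\Phi,\zeta_+,\zeta_-):\mathcal C\to\mathcal C'$ be a morphism of $\mathfrak g$-categorifications satisfying $E'\zeta_-\circ\zeta_+F\circ\Phi\eta_2=\eta_2'\Phi$ (as maps $\Phi\to E'F'\Phi$). Let $\Psi:\mathcal C'\to\mathcal C$ be the right adjoint of $\Phi$, and let $\zeta_-^\vee:\Psi E'\to E\Psi$ and $\zeta_+^\vee:\Psi F'\to F\Psi$ be the isomorphisms induced from $\zeta_-$ and $\zeta_+$ by adjunction. Then $(\Psi,\zeta_-^\vee,\zeta_+^\vee):\mathcal C'\to\mathcal C$ is a morphism of $\mathfrak g$-categorifications.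
   Context: $k$ is an infinite field of characteristic $p\ge0$; $\mathfrak g=\mathfrak{sl}_\infty$ if $p=0$, $\widehat{\mathfrak{sl}}_p$ if $p>0$, with Chevalley generators $e_i,f_i$, simple roots $\alpha_i$ ($i\in\mathbb Z/p\mathbb Z$, viewed inside $k$), weight lattice $P$. An adjunction $(L,R,\eta,\epsilon)$ has $L$ left adjoint to $R$, unit $\eta:1\to RL$ and counit $\epsilon:LR\to1$. **$\mathfrak g$-categorification** on a $k$-linear abelian category $\mathcal C$: an adjoint pair $(E,F)$ of exact endofunctors, $X\in\mathrm{End}(E)$, $\sigma\in\mathrm{End}(E^2)$, and a decomposition $\mathcal C=\bigoplus_{\omega\in P}\mathcal C_\omega$. Let $X^\circ\in\mathrm{End}(F)$ correspond to $X$ by adjunction and let $E_a$, $F_a$ be the generalized $a$-eigensubfunctors of $X$ on $E$ and $X^\circ$ on $F$. One requires: $E=\bigoplus_{i\in\mathbb Z/p\mathbb Z}E_i$; $E_i(\mathcal C_\omega)\subset\mathcal C_{\omega+\alpha_i}$, $F_i(\mathcal C_\omega)\subset\mathcal C_{\omega-\alpha_i}$; the $[E_i],[F_i]$ on $K_0(\mathcal C)=\bigoplus_\omega K_0(\mathcal C_\omega)$ give an integrable representation of $\mathfrak g$; $F$ is isomorphic to a left adjoint of $E$; and for all $n$ the degenerate affine Hecke algebra $DH_n$ acts on $E^n$ by $y_i\mapsto E^{n-i}XE^{i-1}$, $\sigma_i\mapsto E^{n-i-1}\sigma E^{i-1}$. Here $DH_n=\mathbb Z[y_1,\dots,y_n]\otimes\mathbb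 Z\mathfrak S_n$, both factors subalgebras, with $\sigma_iy_j=y_j\sigma_i$ for $j\ne i,i+1$ and $\sigma_iy_i-y_{i+1}\sigma_i=1$. **Morphism** $(\Phi,\zeta_+,\zeta_-):\mathcal C\to\mathcal C'$: an additive functor with $\Phi(\mathcal C_\omega)\subset\mathcal C'_\omega$ and isomorphisms $\zeta_+:\Phi E\to E'\Phi$, $\zeta_-:\Phi F\to F'\Phi$ such that (1) $F'\zeta_+\circ\zeta_-E\circ\Phi\eta_1=\eta_1'\Phi$; (2) $\zeta_+\circ\Phi X=X'\Phi\circ\zeta_+$; (3) $E'\zeta_+\circ\zeta_+E\circ\Phi\sigma=\sigma'\Phi\circ E'\zeta_+\circ\zeta_+E$. (For $(\Psi,\zeta_-^\vee,\zeta_+^\vee)$, the second entry plays the role of $\zeta_+$ and the third that of $\zeta_-$.) **Compatible bi-adjunction.** Let $X^\vee\in\mathrm{End}(F)$ and $\sigma^\vee\in\mathrm{End}(F^2)$ correspond to $X,\sigma$ under $(E,F,\eta_1,\epsilon_1)$. Compatibility means that the endomorphisms of $E$ and $E^2$ corresponding to $X^\vee,\sigma^\vee$ under $(F,E,\eta_2,\epsilon_2)$ are $X$ and $\sigma$; similarly for the primed data. **Induced isomorphisms.** Passing to right adjoints in $\zeta_-:\Phi F\to F'\Phi$ (with $E$ right adjoint to $F$ by $(F,E,\eta_2,\epsilon_2)$, likewise primed) gives $\zeta_-^\vee:\Psi E'\to E\Psi$; passing to right adjoints in $\zeta_+:\Phi E\to E'\Phi$ (using $(E,F,\eta_1,\epsilon_1)$,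 likewise primed) gives $\zeta_+^\vee:\Psi F'\to F\Psi$. *)

(* Defs.v *)
From HB Require Import structures.
From mathcomp Require Import all_boot all_algebra perm.
From mathcomp Require Import boolp classical_sets cardinality.
From mathcomp Require Import Rstruct complex.
From mathcomp Require Import freeg.

Set Implicit Arguments.
Unset Strict Implicit.
Unset Printing Implicit Defensive.

Import GRing.Theory.

Local Open Scope ring_scope.

Declare Scope cat_scope.
Delimit Scope cat_scope with cat.
Local Open Scope cat_scope.

Reserved Notation "g \c f" (at level 40, left associativity).
Reserved Notation "G \F F" (at level 40, left associativity).
Reserved Notation "F ~~> G" (at level 55, no associativity).

(* -------------------------------------------------------------------------- *)
(* Linear categories                                                          *)
(* -------------------------------------------------------------------------- *)

Record lincat (k : fieldType) := LinCat {
  ob :> Type;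
  hom : ob -> ob -> lmodType k;
  idm : forall M, hom M M;
  compm : forall {M N T}, hom N T -> hom M N -> hom M T;
  compA : forall M N T U (h : hom T U) (g : hom N T) (f : hom M N),
    compm h (compm g f) = compm (compm h g) f;
  comp1m : forall M N (f : hom M N), compm (idm N) f = f;
  compm1 : forall M N (f : hom M N), compm f (idm M) = f;
  compm_linearl : forall M N T (a : k) (g g' : hom N T) (f : hom M N),
    compm (a *: g + g') f = a *: compm g f + compm g' f;
  compm_linearr : forall M N T (a : k) (g : hom N T) (f f' : hom M N),
    compm g (a *: f + f') = a *: compm g f + compm g f'
}.

Arguments hom {k l} M N.
Arguments idm {k l} M.
Arguments compm {k l M N T} g f.

Notation "g \c f" := (compm g f) : cat_scope.

Section Morphisms.
Variables (k : fieldType) (C : lincat k).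
Implicit Types M N T : C.

Definition is_iso M N (f : hom M N) : Prop :=
  exists g : hom N M, g \c f = idm M /\ f \c g = idm N.

Definition isomorphic M N : Prop := exists f : hom M N, is_iso f.

Definition mono M N (f : hom M N) : Prop :=
  forall T (g h : hom T M), f \c g = f \c h -> g = h.

Definition epi M N (f : hom M N) : Prop :=
  forall T (g h : hom N T), g \c f = h \c f -> g = h.

Definition is_kernel K M N (i : hom K M) (f : hom M N) : Prop :=
  f \c i = 0 /\
  forall T (t : hom T M), f \c t = 0 -> exists! u : hom T K, i \c u = t.

Definition is_cokernel M N Q (f : hom M N) (q : hom N Q) : Prop :=
  q \c f = 0 /\
  forall T (t : hom N T), t \c f = 0 -> exists! u : hom Q T, u \c q = t.

Definition short_exact M N T (f : hom M N) (g : hom N T) : Prop :=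
  is_kernel f g /\ is_cokernel f g.

Definition is_zero M : Prop := idm M = 0.

(* [M] is the biproduct of the finite family [N]; for [n = 0] this says that  *)
(* [M] is a zero object.                                                      *)
Definition is_biprod n (N : 'I_n -> C) M
    (i : forall j, hom (N j) M) (q : forall j, hom M (N j)) : Prop :=
  [/\ forall j, q j \c i j = idm (N j),
      forall j l, j != l -> q j \c i l = 0
    & \sum_(j < n) (i j \c q j) = idm M].

Definition is_coprod (I : Type) (N : I -> C) M
    (i : forall j, hom (N j) M) : Prop :=
  forall T (t : forall j, hom (N j) T),
    exists! u : hom M T, forall j, u \c i j = t j.

Definition factors_through S T M (t : hom T M) (i : hom S M) : Prop :=
  exists u : hom T S, i \c u = t.

(* [i : S -> M] is the generalized [a]-eigenspace of [x : M -> M]: the union  *)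
(* (least upper bound among subobjects) of the kernels of [(x - a)^n].        *)
Definition is_gen_eigen M (x : hom M M) (a : k) S (i : hom S M) : Prop :=
  let killed T (t : hom T M) :=
    exists n, iter n (fun u => (x - a *: idm M) \c u) t = 0 in
  [/\ mono i,
      forall T (t : hom T M), killed T t -> factors_through t i
    & forall S' (i' : hom S' M), mono i' ->
        (forall T (t : hom T M), killed T t -> factors_through t i') ->
        factors_through i i'].

End Morphisms.

Definition abelian (k : fieldType) (C : lincat k) : Prop :=
  [/\ forall n (N : 'I_n -> C), exists M i q, @is_biprod _ C n N M i q,
      forall (M N : C) (f : hom M N), exists K (i : hom K M), is_kernel i f,
      forall (M N : C) (f : hom M N), exists Q (q : hom N Q), is_cokernel f q,
      forall (M N : C) (f : hom M N), mono f ->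
        exists T (g : hom N T), is_kernel f g
    & forall (M N : C) (f : hom M N), epi f ->
        exists T (g : hom T M), is_cokernel g f].

(* -------------------------------------------------------------------------- *)
(* Functors, natural transformations, adjunctions                             *)
(* -------------------------------------------------------------------------- *)

Record functor (k : fieldType) (C D : lincat k) := Functor {
  fob :> C -> D;
  fmap : forall {M N : C}, hom M N -> hom (fob M) (fob N);
  fmap1 : forall M : C, fmap (idm M) = idm (fob M);
  fmapM : forall (M N T : C) (g : hom N T) (f : hom M N),
    fmap (g \c f) = fmap g \c fmap f
}.

Arguments fmap {k C D} _ {M N} _.

Record nattrans (k : fieldType) (C D : lincat k) (F G : functor C D) :=
  NatTrans {
  nt :> forall M : C, hom (F M) (G M);
  nt_natural : forall (M N : C) (f : hom M N),
    nt N \c fmap F f = fmap G f \c nt M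
}.

Notation "F ~~> G" := (nattrans F G) : cat_scope.

Section Functors.
Variable k : fieldType.
Implicit Types C D B : lincat k.

Definition idF C : functor C C :=
  @Functor k C C id (fun _ _ f => f)
    (fun _ => erefl) (fun _ _ _ _ _ => erefl).

Lemma compF1 C D B (G : functor D B) (F : functor C D) (M : C) :
  fmap G (fmap F (idm M)) = idm (G (F M)).
Proof. by rewrite !fmap1. Qed.

Lemma compFM C D B (G : functor D B) (F : functor C D) (M N T : C)
    (g : hom N T) (f : hom M N) :
  fmap G (fmap F (g \c f)) = fmap G (fmap F g) \c fmap G (fmap F f).
Proof. by rewrite !fmapM. Qed.

Definition compF C D B (G : functor D B) (F : functor C D) : functor C B :=
  @Functor k C B (fun M => G (F M)) (fun _ _ f => fmap G (fmap F f))
    (compF1 G F) (@compFM _ _ _ G F).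

Fixpoint powF C (F : functor C C) (n : nat) : functor C C :=
  if n is m.+1 then compF F (powF F m) else idF C.

Definition additive_functor C D (F : functor C D) : Prop :=
  forall (M N : C) (f g : hom M N), fmap F (f + g) = fmap F f + fmap F g.

Definition exact_functor C D (F : functor C D) : Prop :=
  additive_functor F /\
  forall (M N T : C) (f : hom M N) (g : hom N T),
    short_exact f g -> short_exact (fmap F f) (fmap F g).

Definition nat_iso C D (F G : functor C D) (t : F ~~> G) : Prop :=
  forall M, is_iso (t M).

End Functors.

Notation "G \F F" := (compF G F) : cat_scope.

Record adjunction (k : fieldType) (C D : lincat k)
    (L : functor C D) (R : functor D C) := Adjunction {
  adj_unit : idF C ~~> R \F L;
  adj_counit : L \F R ~~> idF D;
  triangleL : forall M : C, adj_counit (L M) \c fmap L (adj_unit M) = idm (L M);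
  triangleR : forall N : D, fmap R (adj_counit N) \c adj_unit (R N) = idm (R N)
}.

Section Adjunctions.
Variable k : fieldType.

Section Composition.
Variables (C D B : lincat k).
Variables (L1 : functor C D) (R1 : functor D C).
Variables (L2 : functor D B) (R2 : functor B D).
Variables (A1 : adjunction L1 R1) (A2 : adjunction L2 R2).

Definition adj_comp_eta (M : C) : hom M ((R1 \F R2 \F (L2 \F L1)) M) :=
  fmap R1 (adj_unit A2 (L1 M)) \c adj_unit A1 M.

Definition adj_comp_eps (N : B) : hom ((L2 \F L1 \F (R1 \F R2)) N) N :=
  adj_counit A2 N \c fmap L2 (adj_counit A1 (R2 N)).

Lemma adj_comp_unit_natural (M N : C) (f : hom M N) :
  adj_comp_eta N \c fmap (idF C) f = fmap (R1 \F R2 \F (L2 \F L1)) f \c adj_comp_eta M.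
Proof.
rewrite /adj_comp_eta -compA (nt_natural (adj_unit A1) f) /= !compA -!fmapM.
by rewrite (nt_natural (adj_unit A2) (fmap L1 f)).
Qed.

Lemma adj_comp_counit_natural (M N : B) (f : hom M N) :
  adj_comp_eps N \c fmap (L2 \F L1 \F (R1 \F R2)) f = fmap (idF B) f \c adj_comp_eps M.
Proof.
rewrite /adj_comp_eps compA -(nt_natural (adj_counit A2) f) /= -!compA -!fmapM.
by rewrite (nt_natural (adj_counit A1) (fmap R2 f)).
Qed.

Lemma adj_comp_triangleL (M : C) :
  adj_comp_eps ((L2 \F L1) M) \c fmap (L2 \F L1) (adj_comp_eta M) = idm ((L2 \F L1) M).
Proof.
rewrite /adj_comp_eps /adj_comp_eta /= -compA -fmapM (fmapM L1) compA.
have /= -> := nt_natural (adj_counit A1) (adj_unit A2 (L1 M)).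
rewrite -compA triangleL compm1.
exact: triangleL.
Qed.

Lemma adj_comp_triangleR (N : B) :
  fmap (R1 \F R2) (adj_comp_eps N) \c adj_comp_eta ((R1 \F R2) N) = idm ((R1 \F R2) N).
Proof.
rewrite /adj_comp_eps /adj_comp_eta /= compA -fmapM (fmapM R2) -compA.
have /= <- := nt_natural (adj_unit A2) (adj_counit A1 (R2 N)).
rewrite compA triangleR comp1m.
exact: triangleR.
Qed.

Definition adj_comp : adjunction (L2 \F L1) (R1 \F R2) :=
  @Adjunction k C B (L2 \F L1) (R1 \F R2)
    (@NatTrans k C C (idF C) (R1 \F R2 \F (L2 \F L1)) adj_comp_eta adj_comp_unit_natural)
    (@NatTrans k B B (L2 \F L1 \F (R1 \F R2)) (idF B) adj_comp_eps adj_comp_counit_natural)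
    adj_comp_triangleL adj_comp_triangleR.

End Composition.

Section Mate.
Variables (C D : lincat k) (L L' : functor C D) (R R' : functor D C).
Variables (A : adjunction L R) (A' : adjunction L' R') (t : L ~~> L').

Definition rmate_at (N : D) : hom (R' N) (R N) :=
  fmap R (adj_counit A' N) \c fmap R (t (R' N)) \c adj_unit A (R' N).

Lemma rmate_natural (M N : D) (f : hom M N) :
  rmate_at N \c fmap R' f = fmap R f \c rmate_at M.
Proof.
rewrite /rmate_at -!compA.
have /= -> := nt_natural (adj_unit A) (fmap R' f).
rewrite !compA -!fmapM -[in LHS]compA (nt_natural t (fmap R' f)) compA.
by have /= -> := nt_natural (adj_counit A') f.
Qed.

(* The transformation of right adjoints R' -> R corresponding to L -> L'.     *)
Definition rmate : R' ~~> R := NatTrans rmate_natural.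

End Mate.

End Adjunctions.

(* -------------------------------------------------------------------------- *)
(* Index set and weight lattice of g                                          *)
(* -------------------------------------------------------------------------- *)

Definition has_characteristic (k : fieldType) (p : nat) : Prop :=
  if p is 0 then [pchar k] =i pred0 else p \in [pchar k].

Section PrimeSubring.
Variable k : fieldType.

Definition prime_subring : {pred k} :=
  fun x => `[< exists m : int, x = m%:~R >].

Lemma prime_subring_closed : subring_closed prime_subring.
Proof.
split=> [|x y /asboolP[m ->] /asboolP[n ->]|x y /asboolP[m ->] /asboolP[n ->]].
- by apply/asboolP; exists 1.
- by apply/asboolP; exists (m - n); rewrite intrB.
- by apply/asboolP; exists (m * n); rewrite intrM.
Qed.

HB.instance Definition _ :=
  GRing.isSubringClosed.Build k prime_subring prime_subring_closed.

(* Z/pZ viewed inside k: the image of Z -> k. In characteristic 0 this is     *)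
(* the ring Z, not the prime field.                                           *)
Record residue := Residue {
  residue_val :> k;
  residue_valP : residue_val \in prime_subring
}.

HB.instance Definition _ := [isSub for residue_val].
HB.instance Definition _ := [Choice of residue by <:].
HB.instance Definition _ := [SubChoice_isSubComNzRing of residue by <:].

End PrimeSubring.

Section Weights.
Variables (k : fieldType) (p : nat).

(* P has Z-basis the fundamental weights Lambda_i and, when p > 0 only, the   *)
(* null root delta; [{_ : unit | (0 < p)%N}] has one element if p > 0 and     *)
(* none if p = 0.                                                             *)
Definition weight_basis : choiceType :=
  (residue k + {_ : unit | (0 < p)%N})%type.

Definition weight : zmodType := {freeg weight_basis / int}.

Definition fundamental_weight (i : residue k) : weight :=
  << (inl i : weight_basis) >>.

Definition null_root : weight :=
  if insub tt is Some u then << (inr u : weight_basis) >> else 0.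

(* <h_i, w>, with <h_i, Lambda_j> = (i == j) and <h_i, delta> = 0.            *)
Definition coroot (i : residue k) (w : weight) : int :=
  coeff (inl i : weight_basis) w.

(* When p = 2 the two neighbours of i coincide, which gives the Cartan        *)
(* integers -2 of type A_1^(1). The delta-coordinate is <d, alpha_i>, equal   *)
(* to 1 for i = 0 and to 0 otherwise, so that sum_i alpha_i = delta.          *)
Definition simple_root (i : residue k) : weight :=
  fundamental_weight i *+ 2 - fundamental_weight (i - 1)
    - fundamental_weight (i + 1) + (if i == 0 then null_root else 0).

Definition cartan (i j : residue k) : int := coroot i (simple_root j).

End Weights.

(* -------------------------------------------------------------------------- *)
(* Integrable representations of g                                            *)
(* -------------------------------------------------------------------------- *)

Definition CC : fieldType := complex Rdefinitions.R.

Inductive lspan (V : lmodType CC) (S : V -> Prop) : V -> Prop :=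
| lspan_gen v of S v : lspan S v
| lspan_zero : lspan S 0
| lspan_add u v of lspan S u & lspan S v : lspan S (u + v)
| lspan_scale (c : CC) v of lspan S v : lspan S (c *: v).

Section IntegrableRep.
Variables (k : fieldType) (p : nat) (V : lmodType CC).

Definition weight_space_decomposition (Vw : weight k p -> V -> Prop) : Prop :=
  [/\ forall w, [/\ Vw w 0, forall u v, Vw w u -> Vw w v -> Vw w (u + v)
        & forall (c : CC) v, Vw w v -> Vw w (c *: v)],
      forall v, exists n (w : 'I_n -> weight k p) (u : 'I_n -> V),
        [/\ injective w, forall j, Vw (w j) (u j) & v = \sum_j u j]
    & forall n (w : 'I_n -> weight k p) (u : 'I_n -> V),
        injective w -> (forall j, Vw (w j) (u j)) -> \sum_j u j = 0 ->
        forall j, u j = 0].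

Definition commutator (x y : V -> V) : V -> V := fun v => x (y v) - y (x v).

(* The Chevalley-Serre relations of g on a weight module: the Cartan          *)
(* subalgebra acts on [Vw w] through the weight [w], so that h_i acts as      *)
(* <h_i, w> and the relations [h, e_i] = alpha_i(h) e_i,                      *)
(* [h, f_i] = - alpha_i(h) f_i say that e_i and f_i shift weights by          *)
(* alpha_i and - alpha_i.                                                     *)
Definition integrable_rep (Vw : weight k p -> V -> Prop)
    (e f : residue k -> {linear V -> V}) : Prop :=
  [/\ weight_space_decomposition Vw,
      forall i w v, Vw w v -> Vw (w + simple_root p i) (e i v)
        /\ Vw (w - simple_root p i) (f i v),
      forall i j w v, Vw w v ->
        commutator (e i) (f j) v
          = if i == j then (coroot i w)%:~R *: v else 0,
      forall i j, i != j -> forall v,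
        iter `|1 - cartan p i j|%N (commutator (e i)) (e j) v = 0
        /\ iter `|1 - cartan p i j|%N (commutator (f i)) (f j) v = 0
    & forall i v, exists n, iter n (e i) v = 0 /\ iter n (f i) v = 0].

End IntegrableRep.

(* -------------------------------------------------------------------------- *)
(* Complexified Grothendieck group                                            *)
(* -------------------------------------------------------------------------- *)

Section Grothendieck.
Variables (k : fieldType) (C : lincat k).

Definition K0_free : lmodType CC := {freeg {classic C} / CC}.
Definition K0_gen (M : C) : K0_free := << (M : {classic C}) >>.

Definition K0_relator (x : K0_free) : Prop :=
  exists M N T (f : @hom k C M N) (g : @hom k C N T),
    short_exact f g /\ x = K0_gen N - K0_gen M - K0_gen T.

Definition K0_rel : {pred {freeg {classic C} / CC}} :=
  fun x => `[< lspan K0_relator x >].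

Lemma K0_rel_closed : zmod_closed K0_rel.
Proof.
split=> [|x y /asboolP hx /asboolP hy]; apply/asboolP; first exact: lspan_zero.
by apply: lspan_add => //; rewrite -scaleN1r; exact: lspan_scale.
Qed.

HB.instance Definition _ :=
  GRing.isZmodClosed.Build {freeg {classic C} / CC} K0_rel K0_rel_closed.

(* The complexification of K_0(C), built directly as the complex vector       *)
(* space spanned by the objects modulo [N] = [M] + [T] for every short exact  *)
(* sequence M -> N -> T.                                                      *)
Definition K0 : Type := Quotient.quot K0_rel.

HB.instance Definition _ := GRing.Zmodule.on K0.

Definition K0_pi (x : K0_free) : K0 := \pi_(Quotient.quot K0_rel)%qT x.

Let piP x y : lspan K0_relator (x - y) -> K0_pi x = K0_pi y.
Proof.
by move=> h; apply/eqmodP; rewrite /= Quotient.equivE; apply/asboolP.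
Qed.

Let piE x y : K0_pi x = K0_pi y -> lspan K0_relator (x - y).
Proof. by move=> /eqmodP; rewrite /= Quotient.equivE => /asboolP. Qed.

Let piD : {morph K0_pi : x y / x + y}.
Proof. exact: Quotient.pi_add. Qed.

Let K0_ind (x : K0) : exists y : K0_free, x = K0_pi y.
Proof. by exists (repr x); rewrite /K0_pi reprK. Qed.

Definition K0_scale (c : CC) (x : K0) : K0 := K0_pi (c *: (repr x : K0_free)).

Let K0_scale_pi c x : K0_scale c (K0_pi x) = K0_pi (c *: x).
Proof.
apply: piP; rewrite -scalerBr; apply: lspan_scale.
by apply: piE; rewrite /K0_pi reprK.
Qed.

Lemma K0_scaleA a b v : K0_scale a (K0_scale b v) = K0_scale (a * b) v.
Proof. by have [x ->] := K0_ind v; rewrite !K0_scale_pi scalerA. Qed.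

Lemma K0_scale1 : left_id 1 K0_scale.
Proof. by move=> v; have [x ->] := K0_ind v; rewrite K0_scale_pi scale1r. Qed.

Lemma K0_scaleDr : right_distributive K0_scale +%R.
Proof.
move=> a u v; have [x ->] := K0_ind u; have [y ->] := K0_ind v.
by rewrite -piD !K0_scale_pi scalerDr piD.
Qed.

Lemma K0_scaleDl v : {morph K0_scale^~ v : a b / a + b}.
Proof.
by move=> a b; have [x ->] := K0_ind v; rewrite !K0_scale_pi scalerDl piD.
Qed.

HB.instance Definition _ := GRing.Zmodule_isLmodule.Build CC K0
  K0_scaleA K0_scale1 K0_scaleDr K0_scaleDl.

Definition K0_class (M : C) : K0 := K0_pi (K0_gen M).

End Grothendieck.

(* -------------------------------------------------------------------------- *)
(* g-categorifications                                                        *)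
(* -------------------------------------------------------------------------- *)

(* [cat_adj] is the adjunction (E, F, eta_1, epsilon_1).                      *)
Record cat_data (k : fieldType) (p : nat) := CatData {
  cat_of :> lincat k;
  cat_E : functor cat_of cat_of;
  cat_F : functor cat_of cat_of;
  cat_adj : adjunction cat_E cat_F;
  cat_X : cat_E ~~> cat_E;
  cat_sigma : cat_E \F cat_E ~~> cat_E \F cat_E;
  cat_wt : weight k p -> cat_of -> Prop
}.

Section Categorification.
Variables (k : fieldType) (p : nat) (C : cat_data k p).

Local Notation E := (cat_E C).
Local Notation F := (cat_F C).
Local Notation X := (cat_X C).
Local Notation sigma := (cat_sigma C).
Local Notation wt := (@cat_wt k p C).

(* [wt w] is the object class of C_w, a full subcategory of C closed under    *)
(* isomorphism; C is the direct sum of these subcategories.                   *)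
Definition weight_decomposition : Prop :=
  [/\ forall w (M N : C), isomorphic M N -> wt w M -> wt w N,
      forall w (M : C), is_zero M -> wt w M,
      forall w w' (M N : C), w != w' -> wt w M -> wt w' N ->
        forall f : hom M N, f = 0
    & forall M : C, exists n (w : 'I_n -> weight k p) (N : 'I_n -> C) i q,
        [/\ injective w, forall j, wt (w j) (N j) & @is_biprod _ C n N M i q]].

(* The endomorphisms of F and of F^2 corresponding to X and sigma.            *)
Definition cat_Xv : F ~~> F := rmate (cat_adj C) (cat_adj C) X.

Definition cat_sigmav : F \F F ~~> F \F F :=
  rmate (adj_comp (cat_adj C) (cat_adj C)) (adj_comp (cat_adj C) (cat_adj C)) sigma.

(* Indices are counted from 0: [heckeY n j] is E^(n-1-j) X E^j, the action of *)
(* y_(j+1), and [heckeS n j] is E^(n-2-j) sigma E^j, the action of            *)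
(* sigma_(j+1).                                                               *)
Fixpoint heckeY (n j : nat) (M : C) : hom (powF E n M) (powF E n M) :=
  match n return hom (powF E n M) (powF E n M) with
  | 0 => 0
  | m.+1 => if j == m then X (powF E m M) else fmap E (heckeY m j M)
  end.

Fixpoint heckeS (n j : nat) (M : C) : hom (powF E n M) (powF E n M) :=
  match n return hom (powF E n M) (powF E n M) with
  | 0 => 0
  | m.+1 =>
    match m return
      hom (powF E m M) (powF E m M) -> hom (E (powF E m M)) (E (powF E m M))
    with
    | 0 => fun _ => 0
    | l.+1 => fun s => if j == l then sigma (powF E l M) else fmap E s
    end (heckeS m j M)
  end.

(* A ring morphism DH_n -> End(E^n) with the prescribed values on generators: *)
(* a group morphism [rho] from the symmetric group, commuting endomorphisms   *)
(* y_j, and the mixed relations of DH_n.                                      *)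
Definition hecke_acts (n : nat) : Prop :=
  (exists rho : 'S_n -> (powF E n ~~> powF E n),
    [/\ forall M, rho 1%g M = idm (powF E n M),
        forall s t M, rho (s * t)%g M = rho s M \c rho t M
      & forall (i j : 'I_n) M, j = i.+1 :> nat ->
          rho (tperm i j) M = heckeS n i M]) /\
  forall M : C,
    [/\ forall i j, (i < n)%N -> (j < n)%N ->
          heckeY n i M \c heckeY n j M = heckeY n j M \c heckeY n i M,
        forall i j, (i.+1 < n)%N -> (j < n)%N -> j != i -> j != i.+1 ->
          heckeS n i M \c heckeY n j M = heckeY n j M \c heckeS n i M
      & forall i, (i.+1 < n)%N ->
          heckeS n i M \c heckeY n i M - heckeY n i.+1 M \c heckeS n i M
            = idm (powF E n M)].

Definition K0_weight (w : weight k p) : K0 C -> Prop :=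
  lspan (fun v => exists M : C, wt w M /\ v = K0_class M).

(* [integrable_rep K0_weight e f] takes K_0(C_w) as the w-weight space.       *)
Definition is_categorification : Prop :=
  [/\ abelian C, exact_functor E /\ exact_functor F, weight_decomposition,
      exists (Ei Fi : residue k -> functor C C)
             (iE : forall i, Ei i ~~> E) (iF : forall i, Fi i ~~> F),
        [/\ forall i M, is_gen_eigen (X M) (val i) (iE i M)
              /\ is_gen_eigen (cat_Xv M) (val i) (iF i M),
            forall M, is_coprod (fun i => iE i M),
            forall i w M, wt w M -> wt (w + simple_root p i) (Ei i M)
              /\ wt (w - simple_root p i) (Fi i M)
          & exists e f : residue k -> {linear K0 C -> K0 C},
              (forall i M, e i (K0_class M) = K0_class (Ei i M)
                /\ f i (K0_class M) = K0_class (Fi i M))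
              /\ integrable_rep K0_weight e f]
    & (exists (L : functor C C) (_ : adjunction L E) (t : F ~~> L), nat_iso t)
      /\ forall n, hecke_acts n].

Definition compatible_biadjunction (A2 : adjunction F E) : Prop :=
  (forall M, rmate A2 A2 cat_Xv M = X M) /\
  (forall M, rmate (adj_comp A2 A2) (adj_comp A2 A2) cat_sigmav M = sigma M).

End Categorification.

Definition is_cat_morphism (k : fieldType) (p : nat) (C C' : cat_data k p)
    (Phi : functor C C')
    (zp : Phi \F cat_E C ~~> cat_E C' \F Phi)
    (zm : Phi \F cat_F C ~~> cat_F C' \F Phi) : Prop :=
  [/\ additive_functor Phi,
      forall w M, cat_wt w M -> cat_wt w (Phi M),
      nat_iso zp /\ nat_iso zm,
      forall M, fmap (cat_F C') (zp M) \c zm (cat_E C M)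
                  \c fmap Phi (adj_unit (cat_adj C) M)
                = adj_unit (cat_adj C') (Phi M)
    & (forall M, zp M \c fmap Phi (cat_X C M) = cat_X C' (Phi M) \c zp M) /\
      (forall M, fmap (cat_E C') (zp M) \c zp (cat_E C M)
                   \c fmap Phi (cat_sigma C M)
                 = cat_sigma C' (Phi M)
                   \c (fmap (cat_E C') (zp M) \c zp (cat_E C M)))].

(* Main.v *)
Require Import Defs.
From mathcomp Require Import all_boot all_algebra.
From mathcomp Require Import classical_sets cardinality.
Local Open Scope classical_set_scope.
Local Open Scope cat_scope.

(** Passing to right adjoints reverses every diagram. Under the adjunctions
    [(E, F)] and [(F, E)] the mate of [eta_1] is [epsilon_2], so the unit axiom
    for [Psi] is the mate of the counit identity
    [epsilon_2' Phi o F' zeta_+ o zeta_- E = Phi epsilon_2]. As [zeta_-] is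
    invertible, that identity follows from the assumed compatibility of
    [zeta_+, zeta_-] with [eta_2]. In the same way the unit axiom for [Phi]
    makes [zeta_-] the mate of the inverse of [zeta_+], so [zeta_-] intertwines
    [X^vee] and [sigma^vee]; taking mates once more and using the compatibility
    of the bi-adjunctions gives the axioms on [X] and [sigma] for [Psi].
    Finally [Psi M] has no component of weight other than that of [M], because
    [Hom(N, Psi M) = Hom(Phi N, M)] vanishes when [N] and [M] have distinct
    weights. *)

Set Implicit Arguments.
Unset Strict Implicit.
Unset Printing Implicit Defensive.

Import GRing.Theory.
(* A second time, because MathComp shadows [hom] and [compA]. *)
Import Defs.
Local Open Scope ring_scope.

(** * Composition and isomorphisms in linear categories *)

Section LinearCategories.
Variables (k : fieldType) (C : lincat k).

Lemma compmDr (M N T : C) (g : hom N T) (f f' : hom M N) :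
  g \c (f + f') = g \c f + g \c f'.
Proof. by have := compm_linearr 1 g f f'; rewrite !scale1r. Qed.

Lemma compmDl (M N T : C) (g g' : hom N T) (f : hom M N) :
  (g + g') \c f = g \c f + g' \c f.
Proof. by have := compm_linearl 1 g g' f; rewrite !scale1r. Qed.

Lemma comp0m (M N T : C) (f : hom M N) : (0 : hom N T) \c f = 0.
Proof. by apply: (addrI (0 \c f)); rewrite -compmDl !addr0. Qed.

Lemma is_iso_comp (M N T : C) (g : hom N T) (f : hom M N) :
  is_iso g -> is_iso f -> is_iso (g \c f).
Proof.
move=> [g' [g'g gg']] [f' [f'f ff']]; exists (f' \c g'); split.
  by rewrite -compA (compA g') g'g comp1m.
by rewrite -compA (compA f) ff' comp1m.
Qed.

Lemma is_iso_epi (M N T : C) (f : hom M N) (g h : hom N T) :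
  is_iso f -> g \c f = h \c f -> g = h.
Proof.
move=> [f' [_ ff']] /(congr1 (fun u => u \c f')).
by rewrite -!compA ff' !compm1.
Qed.

End LinearCategories.

Lemma is_iso_fmap (k : fieldType) (C D : lincat k) (G : functor C D)
    (M N : C) (f : hom M N) : is_iso f -> is_iso (fmap G f).
Proof.
by move=> [f' [f'f ff']]; exists (fmap G f'); rewrite -!fmapM f'f ff' !fmap1.
Qed.

(** * Mates of transformations under adjunctions *)

Section Mates.
Variables (k : fieldType) (C D : lincat k).

(** A map into [R N] is recovered from its transpose by applying [R] and precomposing with the unit.
    Below, equalities of maps into right adjoints are checked on transposes. *)
Lemma adj_transpose_inj (L : functor C D) (R : functor D C)
    (A : adjunction L R) (M : C) (N : D) (f g : hom M (R N)) :
  adj_counit A N \c fmap L f = adj_counit A N \c fmap L g -> f = g.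
Proof.
move=> fg; have E (h : hom M (R N)) :
    h = fmap R (adj_counit A N \c fmap L h) \c adj_unit A M.
  have /= nat_h := nt_natural (adj_unit A) h.
  by rewrite fmapM -compA -nat_h compA triangleR comp1m.
by rewrite (E f) (E g) fg.
Qed.

Arguments adj_transpose_inj {L R} A {M N f g} _.

(** This equation characterizes the mate; later computations with mates go through it. *)
Lemma rmateE (L L' : functor C D) (R R' : functor D C)
    (A : adjunction L R) (A' : adjunction L' R') (t : L ~~> L') (N : D) :
  adj_counit A N \c fmap L (rmate A A' t N) = adj_counit A' N \c t (R' N).
Proof.
rewrite /= /rmate_at -(fmapM R) (fmapM L) compA.
have /= -> := nt_natural (adj_counit A) (adj_counit A' N \c t (R' N)).
by rewrite -compA triangleL compm1.
Qed.

Lemma rmate_iso (L L' : functor C D) (R R' : functor D C)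
    (A : adjunction L R) (A' : adjunction L' R') (t : L ~~> L') :
  nat_iso t -> nat_iso (rmate A A' t).
Proof.
move=> t_iso N; have [s [st ts]] := t_iso (R N).
(* The mate of the inverse of [t], which involves that inverse only at [R N]. *)
pose g : hom (R N) (R' N) := fmap R' (adj_counit A N \c s) \c adj_unit A' (R N).
have gE : adj_counit A' N \c fmap L' g = adj_counit A N \c s.
  rewrite /g (fmapM L') compA.
  have /= -> := nt_natural (adj_counit A') (adj_counit A N \c s).
  by rewrite -compA triangleL compm1.
exists g; split.
  apply: (adj_transpose_inj A'); apply: (is_iso_epi (t_iso _)).
  rewrite fmap1 compm1 fmapM compA gE -compA -(nt_natural t).
  by rewrite compA -(compA _ s) st compm1 rmateE.
apply: (adj_transpose_inj A).
rewrite fmapM compA rmateE fmap1 compm1 -compA (nt_natural t) compA gE.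
by rewrite -compA st compm1.
Qed.

End Mates.

Arguments adj_transpose_inj {k C D L R} A {M N f g} _.

(** The transpose of [fmap R h] is [h] composed with the counit, hence additive in [h]. *)
Lemma right_adjoint_additive (k : fieldType) (C D : lincat k)
    (L : functor C D) (R : functor D C) (A : adjunction L R) :
  additive_functor L -> additive_functor R.
Proof.
move=> L_add M N f g; apply: (adj_transpose_inj A).
have natE h := nt_natural (adj_counit A) h.
rewrite /= in natE.
by rewrite L_add compmDr !natE compmDl.
Qed.

(** * Squares of functors between two adjunctions *)

Section AdjointSquares.
Variables (k : fieldType) (C D C' D' : lincat k).
Variables (L : functor C D) (R : functor D C) (A : adjunction L R).
Variables (L' : functor C' D') (R' : functor D' C') (A' : adjunction L' R').
Variables (P : functor C C') (Q : functor D D').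
Variables (a : Q \F L ~~> L' \F P) (b : P \F R ~~> R' \F Q).

(** For [(E, F)] this is the unit axiom of a morphism; the general form also covers [(F, E)] and
    composite adjunctions. *)
Definition unit_compat := forall M : C,
  fmap R' (a M) \c b (L M) \c fmap P (adj_unit A M) = adj_unit A' (P M).

Lemma counit_compat : nat_iso a -> unit_compat -> forall N : D,
  adj_counit A' (Q N) \c fmap L' (b N) \c a (R N) = fmap Q (adj_counit A N).
Proof.
move=> a_iso ab N; have [a' [a'a aa']] := a_iso (R N).
(* [b] is the mate of the inverse of [a]. *)
have bE : b N = fmap R' (fmap Q (adj_counit A N) \c a') \c adj_unit A' (P (R N)).
  rewrite -ab !compA -fmapM -(compA _ a') a'a compm1.
  have /= <- := nt_natural b (adj_counit A N).
  by rewrite -compA -fmapM triangleR fmap1 compm1.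
rewrite bE (fmapM L') (compA (adj_counit A' (Q N))).
have /= -> := nt_natural (adj_counit A') (fmap Q (adj_counit A N) \c a').
by rewrite -(compA _ _ (fmap L' _)) triangleL compm1 -compA a'a compm1.
Qed.

(** After transposing and precomposing with [a], [counit_compat] trades [b] for counits, and the
    commutation of [a] with [X] remains. *)
Lemma rmate_intertwines (X : L ~~> L) (X' : L' ~~> L') :
  nat_iso a -> unit_compat ->
  (forall M, a M \c fmap Q (X M) = X' (P M) \c a M) ->
  forall N, b N \c fmap P (rmate A A X N) = rmate A' A' X' (Q N) \c b N.
Proof.
move=> a_iso ab aX N; apply: (adj_transpose_inj A').
apply: (is_iso_epi (a_iso _)).
rewrite (fmapM L' (b N)) (fmapM L' (rmate A' A' X' (Q N))).
rewrite (compA _ (fmap L' (rmate A' A' X' (Q N)))) rmateE.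
have /= nat_a := nt_natural a (rmate A A X N).
rewrite -(compA _ _ (a _)) -(compA (fmap L' (b N))) -nat_a.
rewrite !compA counit_compat // -(fmapM Q) rmateE (fmapM Q).
by rewrite -(compA _ _ (fmap L' (b N))) (nt_natural X') compA -(compA _ _ (a _))
           -aX compA counit_compat.
Qed.

Section Adjoint.
Variables (Pr : functor C' C) (AP : adjunction P Pr).
Variables (Qr : functor D' D) (AQ : adjunction Q Qr).

(** With [P] and [Q] both equal to [Phi], the square [zm] over [(F, E)] yields [zmv], and [zp] over
    [(E, F)] yields [zpv]. *)
Definition square_rmate : Pr \F R' ~~> R \F Qr :=
  rmate (adj_comp A AQ) (adj_comp AP A') a.

Lemma square_rmateE (N : D') :
  adj_counit AQ N \c fmap Q (adj_counit A (Qr N) \c fmap L (square_rmate N))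
  = adj_counit A' N \c fmap L' (adj_counit AP (R' N)) \c a (Pr (R' N)).
Proof.
by rewrite fmapM compA; exact: (rmateE (adj_comp A AQ) (adj_comp AP A') a).
Qed.

Lemma square_rmate_intertwines (X : L ~~> L) (X' : L' ~~> L') :
  (forall M, a M \c fmap Q (X M) = X' (P M) \c a M) ->
  forall N, square_rmate N \c fmap Pr (rmate A' A' X' N)
    = rmate A A X (Qr N) \c square_rmate N.
Proof.
have XE := rmateE A A X; have XE' := rmateE A' A' X'.
(* The mates become abstract, known only through their transposes. *)
move: square_rmate square_rmateE (rmate A A X) XE (rmate A' A' X') XE'.
move=> s sE Y YE Y' YE' aX N.
apply: (adj_transpose_inj A); apply: (adj_transpose_inj AQ).
have /= nat_a := nt_natural a (fmap Pr (Y' N)).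
have /= nat_e := nt_natural (adj_counit AP) (Y' N).
rewrite !(fmapM L) !compA (fmapM Q _ (fmap L (fmap Pr _))) compA sE YE.
rewrite -(compA _ (X _)) (nt_natural X) compA (fmapM Q _ (X _)) compA sE.
rewrite -!(compA _ (a _)) aX nat_a !compA -!(compA _ (fmap L' (adj_counit AP _))).
by rewrite -(fmapM L') nat_e (fmapM L') -(nt_natural X') !compA YE'.
Qed.

End Adjoint.
End AdjointSquares.

Arguments unit_compat {k C D C' D' L R} A {L' R'} A' {P Q} a b.
Arguments square_rmate {k C D C' D' L R} A {L' R'} A' {P Q} a {Pr} AP {Qr} AQ.

(** * The unit condition for right adjoint squares *)

Section UnitOfAdjointSquare.
Variables (k : fieldType) (C D C' D' : lincat k).
Variables (L : functor C D) (R : functor D C).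
Variables (A : adjunction L R) (A2 : adjunction R L).
Variables (L' : functor C' D') (R' : functor D' C').
Variables (A' : adjunction L' R') (A2' : adjunction R' L').
Variables (P : functor C C') (Pr : functor C' C) (AP : adjunction P Pr).
Variables (Q : functor D D') (Qr : functor D' D) (AQ : adjunction Q Qr).
Variables (a : Q \F L ~~> L' \F P) (b : P \F R ~~> R' \F Q).

Lemma square_rmate_unit_compat :
  nat_iso b -> unit_compat A2 A2' b a ->
  unit_compat A' A (square_rmate A2 A2' b AQ AP) (square_rmate A A' a AP AQ).
Proof.
move=> b_iso ba N.
have counit_N := counit_compat b_iso ba (Pr N).
have aE := square_rmateE A A' a AP AQ; have bE := square_rmateE A2 A2' b AQ AP.
move: (square_rmate A A' a AP AQ) aE (square_rmate A2 A2' b AQ AP) bE.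
move=> s sE t tE.
(* Transposing under [A] turns its unit into an identity, and under [A2] into the counit of [A2].
   After the third transposition the goal is [counit_N] followed by the counit of [AP]. *)
apply: (adj_transpose_inj A); apply: (adj_transpose_inj A2).
apply: (adj_transpose_inj AP).
have /= nat_1 := nt_natural (adj_counit A) (t N).
have /= nat_b := nt_natural b.
have /= nat_a := nt_natural a (fmap Pr (adj_unit A' N)).
have /= nat_e := nt_natural (adj_counit AP) (adj_unit A' N).
have /= nat_2 := nt_natural (adj_counit A2') (adj_counit AP N).
rewrite triangleL fmap1 compm1.
rewrite -(compA (fmap R (t N))) (fmapM L) compA nat_1 -(compA (t N)).
rewrite (fmapM R) (compA (adj_counit A2 _)) (fmapM P) compA tE.
rewrite -(compA _ (b _)) nat_b compA -(compA (adj_counit A2' N)) -(fmapM R').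
rewrite (fmapM L) (compA (adj_counit A _)) (fmapM Q) compA sE.
rewrite -(compA _ (a _)) nat_a compA -(compA _ (fmap L' (adj_counit AP _))).
rewrite -(fmapM L') nat_e.
rewrite (fmapM L') compA triangleL comp1m (fmapM R') compA nat_2.
by rewrite -counit_N !compA.
Qed.

End UnitOfAdjointSquare.

(** * Pasting of squares, for the axiom on [sigma] *)

Section Pasting.
Variables (k : fieldType) (C D B C' D' B' : lincat k).
Variables (L1 : functor C D) (L2 : functor D B).
Variables (L1' : functor C' D') (L2' : functor D' B').
Variables (P : functor C C') (Q : functor D D') (S : functor B B').

Definition paste_at (a1 : Q \F L1 ~~> L1' \F P) (a2 : S \F L2 ~~> L2' \F Q)
    (M : C) : hom ((S \F (L2 \F L1)) M) ((L2' \F L1' \F P) M) :=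
  fmap L2' (a1 M) \c a2 (L1 M).

Lemma paste_natural a1 a2 (M N : C) (f : hom M N) :
  paste_at a1 a2 N \c fmap (S \F (L2 \F L1)) f
  = fmap (L2' \F L1' \F P) f \c paste_at a1 a2 M.
Proof.
rewrite /paste_at -compA; have /= -> := nt_natural a2 (fmap L1 f).
by rewrite !compA -!fmapM; have /= -> := nt_natural a1 f.
Qed.

Definition paste a1 a2 : S \F (L2 \F L1) ~~> L2' \F L1' \F P :=
  NatTrans (paste_natural a1 a2).

Lemma paste_iso a1 a2 : nat_iso a1 -> nat_iso a2 -> nat_iso (paste a1 a2).
Proof. by move=> a1_iso a2_iso M; apply/is_iso_comp/a2_iso/is_iso_fmap/a1_iso. Qed.

End Pasting.

Arguments paste {k C D B C' D' B' L1 L2 L1' L2' P Q S} a1 a2.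

Section PastingAdjoints.
Variables (k : fieldType) (C D B C' D' B' : lincat k).
Variables (L1 : functor C D) (R1 : functor D C) (A1 : adjunction L1 R1).
Variables (L2 : functor D B) (R2 : functor B D) (A2 : adjunction L2 R2).
Variables (L1' : functor C' D') (R1' : functor D' C').
Variables (A1' : adjunction L1' R1').
Variables (L2' : functor D' B') (R2' : functor B' D').
Variables (A2' : adjunction L2' R2').
Variables (P : functor C C') (Q : functor D D') (S : functor B B').
Variables (a1 : Q \F L1 ~~> L1' \F P) (a2 : S \F L2 ~~> L2' \F Q).

(** The order of [b1] and [b2] is reversed because the right adjoint of [L2 \F L1] is [R1 \F R2]. *)
Lemma paste_unit_compat (b1 : P \F R1 ~~> R1' \F Q) (b2 : Q \F R2 ~~> R2' \F S) :
  unit_compat A1 A1' a1 b1 -> unit_compat A2 A2' a2 b2 ->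
  unit_compat (adj_comp A1 A2) (adj_comp A1' A2') (paste a1 a2) (paste b2 b1).
Proof.
move=> c1 c2 M; rewrite /= /paste_at /adj_comp_eta !fmapM.
have /= nat_b1 := nt_natural b1 (adj_unit A2 (L1 M)).
rewrite -!compA (compA (b1 _) (fmap P (fmap R1 _))) nat_b1 !compA.
rewrite -!(compA (fmap R1' (fmap R2' (fmap L2' (a1 M))))) -!fmapM c2.
have /= nat_u := nt_natural (adj_unit A2') (a1 M).
rewrite !compA -(fmapM R1') -nat_u (fmapM R1').
by rewrite -!compA (compA (fmap R1' (a1 M))) c1.
Qed.

Variables (Pr : functor C' C) (AP : adjunction P Pr).
Variables (Qr : functor D' D) (AQ : adjunction Q Qr).
Variables (Sr : functor B' B) (AS : adjunction S Sr).

(** Both sides have the same transpose. This identifies two successive uses of [zmv] with the mate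
    of a single pasted square. *)
Lemma paste_square_rmate (N : B') :
  square_rmate (adj_comp A1 A2) (adj_comp A1' A2') (paste a1 a2) AP AS N
  = fmap R1 (square_rmate A2 A2' a2 AQ AS N)
      \c square_rmate A1 A1' a1 AP AQ (R2' N).
Proof.
apply: (adj_transpose_inj (adj_comp A1 A2)); apply: (adj_transpose_inj AS).
rewrite square_rmateE.
have E1 := square_rmateE A1 A1' a1 AP AQ.
have E2 := square_rmateE A2 A2' a2 AQ AS.
move: (square_rmate A1 A1' a1 AP AQ) E1 (square_rmate A2 A2' a2 AQ AS) E2.
move=> s1 E1 s2 E2.
rewrite /= /adj_comp_eps /paste_at.
have /= nat_e := nt_natural (adj_counit A1) (s2 N).
have nat_a := nt_natural a2.
rewrite -!(compA (adj_counit A2 _)) -!(fmapM L2) !(fmapM L1).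
rewrite (compA (adj_counit A1 _)) nat_e.
rewrite -(compA (s2 N)) (fmapM L2 (s2 N)) (compA (adj_counit A2 _)).
rewrite (fmapM S _ (fmap L2 (_ \c _))) (compA (adj_counit AS _)) E2.
rewrite -!(compA _ (a2 _)) nat_a /= !compA -!(compA (adj_counit A2' _)).
by rewrite -!(fmapM L2') E1 !(fmapM L2') !compA.
Qed.

End PastingAdjoints.

(** * Weights under a right adjoint *)

Lemma right_adjoint_weight (k : fieldType) (p : nat) (C C' : cat_data k p)
    (L : functor C C') (R : functor C' C) (A : adjunction L R) :
  weight_decomposition C -> weight_decomposition C' ->
  (forall w M, cat_wt w M -> cat_wt w (L M)) ->
  forall w M, cat_wt w M -> cat_wt w (R M).
Proof.
move=> [wt_iso wt_zero _ wt_dec] [_ _ wt_orth _] L_wt w M wM.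
have [n [u [N [i [q [u_inj uN [qi _ sum_iq]]]]]]] := wt_dec (R M).
(* The transposes of [i j] and of [0] are both maps from [L (N j)] to [M], objects of distinct
   weights, so both vanish. *)
have i0 j : u j != w -> i j = 0.
  move=> uj; apply: (adj_transpose_inj A).
  have H0 := wt_orth _ _ _ _ uj (L_wt _ _ (uN j)) wM.
  by rewrite [LHS]H0 [RHS]H0.
(* By injectivity of [u] at most one summand has weight [w]: either [R M] is isomorphic to it, or
   [R M] is zero and has every weight. *)
case: (pickP (fun j => u j == w)) => [j /eqP uj | no_w]; last first.
  apply: wt_zero; rewrite /is_zero -sum_iq big1 // => j _.
  by rewrite i0 ?comp0m // no_w.
rewrite -uj; apply: (wt_iso _ (N j)) => //; exists (i j); exists (q j).
split=> //; rewrite -sum_iq (bigD1 j) //= big1 ?addr0 // => l lj.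
by rewrite i0 ?comp0m // -uj; apply: contra_neq lj => /u_inj.
Qed.

(** * The morphism axioms for the right adjoint *)

Theorem proposition9p9 (k : fieldType) (p : nat)
  (k_infinite : infinite_set [set: k]) (k_char : has_characteristic k p)
  (C C' : cat_data k p)
  (hC : is_categorification C) (hC' : is_categorification C')
  (A2 : adjunction (cat_F C) (cat_E C)) (A2' : adjunction (cat_F C') (cat_E C'))
  (A2_compat : compatible_biadjunction A2)
  (A2'_compat : compatible_biadjunction A2')
  (Phi : functor C C')
  (zp : Phi \F cat_E C ~~> cat_E C' \F Phi)
  (zm : Phi \F cat_F C ~~> cat_F C' \F Phi)
  (hPhi : is_cat_morphism zp zm)
  (hunit2 : forall M : C,
     fmap (cat_E C') (zm M) \c zp (cat_F C M) \c fmap Phi (adj_unit A2 M)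
       = adj_unit A2' (Phi M))
  (Psi : functor C' C) (APhi : adjunction Phi Psi) :
  let zmv : Psi \F cat_E C' ~~> cat_E C \F Psi :=
    rmate (adj_comp A2 APhi) (adj_comp APhi A2') zm in
  let zpv : Psi \F cat_F C' ~~> cat_F C \F Psi :=
    rmate (adj_comp (cat_adj C) APhi) (adj_comp APhi (cat_adj C')) zp in
  is_cat_morphism zmv zpv.
Proof.
move=> zmv zpv.
have [_ _ wtC _ _] := hC; have [_ _ wtC' _ _] := hC'.
have [X_compat sigma_compat] := A2_compat.
have [X'_compat sigma'_compat] := A2'_compat.
have [Phi_add Phi_wt [zp_iso zm_iso] unit1 [zpX zpsigma]] := hPhi.
have unit1_compat : unit_compat (cat_adj C) (cat_adj C') zp zm := unit1.
have unit2_compat : unit_compat A2 A2' zm zp := hunit2.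
split.
- exact: right_adjoint_additive APhi Phi_add.
- exact: right_adjoint_weight APhi wtC wtC' Phi_wt.
- by split; exact: rmate_iso.
- exact: (square_rmate_unit_compat (cat_adj C) (cat_adj C') APhi APhi).
split=> M.
  (* Compatibility presents [X] as a double mate: [zm] intertwines the inner mates on [F], and then
     [zmv] the outer ones on [E]. *)
  rewrite -X_compat -X'_compat.
  exact/square_rmate_intertwines/rmate_intertwines.
(* The same double mate argument, now for the pasted squares over the composite adjunctions of [E]
   and [F] with themselves. *)
rewrite -(paste_square_rmate A2 A2 A2' A2' zm zm APhi APhi APhi).
rewrite -sigma_compat -sigma'_compat.
apply: (square_rmate_intertwines (adj_comp A2 A2) (adj_comp A2' A2')
  (a := paste zm zm)).
apply: (rmate_intertwines (a := paste zp zp)) => //.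
  exact: paste_iso.
exact: paste_unit_compat.
Qed.
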